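(* Let $\mathcal{I}$ be an ideal on $\mathbb{N}$. The following assertions are equivalent: (1) $\mathcal{I}$ is a Baire ideal for every Polish space. (2') $\mathcal{I}$ is a Baire ideal for $2^{\mathbb{N}}$. (3') For every monotonic $f\colon 2^{<\mathbb{N}}\to\mathcal{P}(\mathcal{I})$ such that for every $s\in 2^{<\mathbb{N}}$: (i) $f(s)$ is hereditary, and (ii) $\bigcup_{t\succcurlyeq s}f(t)=\mathcal{I}$, there is $\sigma\in 2^{\mathbb{N}}$ such that $\bigcup_{k\in\mathbb{N}}f(\sigma|_k)=\mathcal{I}$.
   Context: An ideal on $\mathbb{N}$ is a family $\mathcal{I}\subset\mathcal{P}(\mathbb{N})$ with $\mathbb{N}\notin\mathcal{I}$, closed under subsets and finite unions; every ideal is assumed to contain the family of all finite subsets of $\mathbb{N}$. For a topological space $X$, $\mathrm{NWD}(X)$ is the family of nowhere dense subsets of $X$. $\mathcal{I}$ is a Baire ideal for $X$ if for every monotonic $F\colon\mathcal{I}\to\mathrm{NWD}(X)$ (i.e. $A\subset B$ implies $F(A)\subset F(B)$) one has $\bigcup\{F(A):A\in\mathcal{I}\}\neq X$. Polish spaces (separable complete metric spaces) are assumed nonempty. $2^{\mathbb{N}}=\{0,1\}^{\mathbb{N}}$ has the product topology; $2^{<\mathbb{N}}$ is the set of finite sequences of $0$'s and $1$'s (including the empty one); for $\sigma\in 2^{\mathbb{N}}$, $\sigma|_k=(\sigma(1),\dots,\sigma(k))$; $s\preccurlyeq t$ (equivalently $t\succcurlyeq s$) means that $t$ extends $s$ (possibly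 $t=s$). A map $f\colon 2^{<\mathbb{N}}\to\mathcal{P}(\mathcal{I})$ is monotonic if $s\preccurlyeq t$ implies $f(s)\subset f(t)$. A family $\mathcal{A}\subset\mathcal{P}(\mathbb{N})$ is hereditary if $B\subset A\in\mathcal{A}$ implies $B\in\mathcal{A}$. *)

(* Defs.v *)
From mathcomp Require Import all_boot all_order all_algebra.
From mathcomp Require Import all_classical all_reals all_analysis.

Set Implicit Arguments.
Unset Strict Implicit.
Unset Printing Implicit Defensive.

Local Open Scope classical_set_scope.

Definition hereditary (T : Type) (F : set (set T)) : Prop :=
  forall A B : set T, B `<=` A -> F A -> F B.

Definition ideal (I : set (set nat)) : Prop :=
  [/\ ~ I [set: nat],
      hereditary I,
      (forall A B, I A -> I B -> I (A `|` B)) &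
      (forall A, finite_set A -> I A)].

Definition nowhere_dense (X : topologicalType) (A : set X) : Prop :=
  (closure A)° = set0.

(* A map defined on I is encoded as a total map of which only the values on I
   are constrained and used. *)
Definition baire_ideal (I : set (set nat)) (X : topologicalType) : Prop :=
  forall F : set nat -> set X,
    (forall A, I A -> nowhere_dense (F A)) ->
    (forall A B, I A -> I B -> A `<=` B -> F A `<=` F B) ->
    \bigcup_(A in I) F A <> [set: X].

Definition separable (X : topologicalType) : Prop :=
  exists2 D : set X, countable D & dense D.

(* The axiom of completeType, for a uniform space without a chosen point. *)
Definition complete (X : uniformType) : Prop :=
  forall F : set_system X, ProperFilter F -> cauchy F ->
    exists x : X, F --> x.

Definition polish (R : realType) (X : metricType R) : Prop :=
  [/\ [set: X] !=set0, separable X & complete X].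

Definition restr (sigma : nat -> bool) (k : nat) : seq bool := mkseq sigma k.

Definition branch_property (I : set (set nat)) : Prop :=
  forall f : seq bool -> set (set nat),
    (forall s, f s `<=` I) ->
    (forall s t, prefix s t -> f s `<=` f t) ->
    (forall s, hereditary (f s)) ->
    (forall s, \bigcup_(t in [set t | prefix s t]) f t = I) ->
    exists sigma : nat -> bool, \bigcup_k f (restr sigma k) = I.

(* Main.v *)
(* On the Cantor space, the two properties are translated into each other: to a
   map F corresponds f(s) = {A | F(A) misses the cylinder of s}, to a map f the
   closed sets F(A) = {sigma | A lies in no f(sigma|k)}. The Cantor space carries
   a Polish metric, and for an arbitrary Polish space X the bits of a sequence are
   read as instructions for a Banach-Mazur play of shrinking open sets U_s. With
   f(s) = {A | F(A) misses U_s and {0, ..., c_s - 1} is not included in A}, where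
   c_s is the number of moves made along s, the finite sets in I force a branch
   exhausting I to make infinitely many moves; its sets U_s then have a common
   point, which lies in no F(A). *)
Require Import Defs.
From HB Require Import structures.
From mathcomp Require Import all_boot all_order all_algebra.
From mathcomp Require Import all_classical all_reals all_analysis.
From mathcomp Require Import lra.

Set Implicit Arguments.
Unset Strict Implicit.

Import Order.TTheory GRing.Theory Num.Theory.

Local Open Scope classical_set_scope.

(** * Initial segments of bit sequences; nowhere dense sets *)

Lemma take_restr (x : nat -> bool) (j k : nat) :
  j <= k -> take j (restr x k) = restr x j.
Proof. by move=> jk; rewrite /restr -map_take take_iota (minn_idPl jk). Qed.

Lemma size_restr (x : nat -> bool) (k : nat) : size (restr x k) = k.
Proof. exact: size_mkseq. Qed.

Lemma prefix_restr (x : nat -> bool) (j k : nat) :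
  j <= k -> prefix (restr x j) (restr x k).
Proof. by move=> jk; rewrite prefixE size_restr take_restr. Qed.

Lemma restr_nth (s : seq bool) : restr (nth false s) (size s) = s.
Proof. exact: mkseq_nth. Qed.

Lemma eq_restrP (x y : nat -> bool) (k : nat) :
  restr x k = restr y k <-> forall i, i < k -> x i = y i.
Proof.
split=> [xy i ik|xy].
  by rewrite -(nth_mkseq false x ik) -(nth_mkseq false y ik) -/(restr x k) xy.
by apply/eq_in_map => i; rewrite mem_iota /= add0n => /xy.
Qed.

(** [V] is [U] minus [closure A]: were it empty, [closure A] would have interior points. *)
Lemma nowhere_dense_avoid (X : topologicalType) (A U : set X) :
  nowhere_dense A -> open U -> U !=set0 ->
  exists V, [/\ open V, V !=set0, V `<=` U & V `&` A = set0].
Proof.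
move=> ndA oU [x Ux]; exists (U `&` ~` closure A); split.
- by apply: openI => //; apply: closed_openC; exact: closed_closure.
- apply/set0P/negP => /eqP UA0.
  suff : (closure A)° x by rewrite ndA.
  apply: filterS (open_nbhs_nbhs (conj oU Ux)) => y Uy.
  apply: contrapT => nAy.
  by suff : set0 y by []; rewrite -UA0.
- exact: subIsetl.
- by rewrite -subset0 => y [[_ nAy]] Ay; apply: nAy; exact: subset_closure.
Qed.

(** * Translation between maps into nowhere dense sets and maps on finite bit sequences *)

Section Cylinders.
(** Coordinates [p] let one argument serve both [cantor_space] and [bit_sequence R]. *)
Variables (X : topologicalType) (p : X -> nat -> bool).
Hypothesis p_surj : forall sigma, exists x, p x = sigma.
Hypothesis nbhs_cylinder : forall x U,
  nbhs x U <-> exists k, [set y | restr (p y) k = restr (p x) k] `<=` U.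

Lemma open_cylinder s : open [set x | restr (p x) (size s) = s].
Proof.
rewrite openE => x /= xs; apply/nbhs_cylinder; exists (size s) => y /=.
by rewrite xs.
Qed.

Lemma cylinder_neq0 s : [set x | restr (p x) (size s) = s] !=set0.
Proof. by have [x px] := p_surj (nth false s); exists x; rewrite /= px restr_nth. Qed.

Lemma branch_property_of_baire_ideal I :
  baire_ideal I X -> branch_property I.
Proof.
move=> baireI f fI fmono fhered fcover.
pose F A := [set x | forall k, ~ f (restr (p x) k) A].
have /baireI : forall A, I A -> nowhere_dense (F A).
  move=> A IA; rewrite /nowhere_dense -subset0 => x /nbhs_cylinder[k kF].
  have : I A by [].
  rewrite -(fcover (restr (p x) k)) => -[t /= st ftA].
  have [y yt] := cylinder_neq0 t.
  have kt : k <= size t by rewrite -(size_restr (p x) k) size_prefix.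
  have ys : restr (p y) k = restr (p x) k.
    move: st; rewrite prefixE size_restr -yt => /eqP <-.
    by rewrite take_restr.
  (* The cylinder of [t] is a neighbourhood of [y], so it would meet [F A], although [A] belongs to
     [f t]. *)
  have yF : closure (F A) y by exact: kF.
  have [z [zF zt]] := yF _ (open_nbhs_nbhs (conj (open_cylinder t) yt)).
  by apply: (zF (size t)); rewrite zt.
have Fmono A B : I A -> I B -> A `<=` B -> F A `<=` F B.
  by move=> IA IB AB x xA k kB; apply: (xA k); exact: fhered kB.
move=> /(_ Fmono) FX.
have [x xF] : exists x, ~ (\bigcup_(A in I) F A) x.
  apply: contrapT => nx; apply: FX; rewrite -subTset => x _.
  by apply: contrapT => xF; apply: nx; exists x.
exists (p x); apply/seteqP; split=> [A [k _ /fI//]|A IA].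
apply: contrapT => nA; apply: xF; exists A => // k kA.
by apply: nA; exists k.
Qed.

Lemma baire_ideal_of_branch_property I :
  hereditary I -> branch_property I -> baire_ideal I X.
Proof.
move=> Ihered branchI F ndF Fmono FX.
pose f s := [set A | I A /\ forall x, restr (p x) (size s) = s -> ~ F A x].
have [| | | |sigma sigmaI] := branchI f.
- by move=> s A [].
- move=> s t st A [IA sA]; split=> // x xt; apply: sA.
  move: (st); rewrite prefixE -xt => /eqP {2}<-; rewrite take_restr //.
  exact: size_prefix st.
- move=> s A B BA [IA sA]; have IB := Ihered _ _ BA IA.
  by split=> // x /sA nA xB; apply: nA; exact: Fmono xB.
- move=> s; apply/seteqP; split=> [A [t _ []//]|A IA].
  have [V [oV [x Vx] Vs VA]] :=
    nowhere_dense_avoid (ndF A IA) (open_cylinder s) (cylinder_neq0 s).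
  have /nbhs_cylinder[k kV] := open_nbhs_nbhs (conj oV Vx).
  (* Long enough to extend [s] and to keep the cylinder inside [V]. *)
  exists (restr (p x) (maxn k (size s))) => /=.
    by rewrite prefixE take_restr ?leq_maxr// (Vs x Vx).
  split=> // y; rewrite size_restr => yx yA.
  suff : set0 y by [].
  rewrite -VA; split=> //; apply: kV => /=.
  rewrite -(take_restr _ (k := maxn k (size s))) ?leq_maxl// yx.
  by rewrite take_restr ?leq_maxl.
have [x px] := p_surj sigma.
have : [set: X] x by [].
rewrite -FX => -[A IA xA]; move: (IA); rewrite -sigmaI => -[k _ [_ /(_ x)]].
by apply; rewrite ?size_restr ?px.
Qed.

End Cylinders.

(** * The Cantor space and its Polish metric *)

Lemma nbhs_cantor_space (x : cantor_space) (U : set cantor_space) :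
  nbhs x U <->
  exists k, [set y : cantor_space | restr y k = restr x k] `<=` U.
Proof.
pose cyl k := [set y : cantor_space | restr y k = restr x k].
split=> [xU|[k kU]]; last first.
  apply: filterS kU _; elim: k => [|k IH]; first exact: filterS filterT.
  have xk : nbhs (proj k x) [set x k].
    by apply: open_nbhs_nbhs; split=> //; exact: discrete_open.
  have := @proj_continuous nat (fun=> bool) k x _ xk.
  apply: filterS2 IH => y /eq_restrP yx yk; apply/eq_restrP => i.
  by rewrite ltnS leq_eqVlt => /predU1P[->//|/yx].
(* The filter generated by the cylinders converges to [x] coordinatewise, hence in the product
   topology. *)
have Gfilter : Filter (filter_from setT cyl).
  apply: filter_from_filter; first by exists 0.
  move=> i j _ _; exists (maxn i j) => // y /eq_restrP xy.
  by split; apply/eq_restrP => l li; apply: xy; rewrite leq_max li ?orbT.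
suff /(_ U xU)[k _ kU] : filter_from setT cyl --> x by exists k.
apply/pointwise_cvgP => t V /= xV; exists t.+1 => // y /eq_restrP yx /=; rewrite yx//.
exact: nbhs_singleton xV.
Qed.

(* The parameter [R] only records in which field the metric takes its values. *)
Definition bit_sequence (R : realType) : Type := nat -> bool.

HB.instance Definition _ (R : realType) := gen_eqMixin (bit_sequence R).
HB.instance Definition _ (R : realType) := gen_choiceMixin (bit_sequence R).

Section BitSequenceMetric.
Variable R : realType.
Implicit Types x y z : bit_sequence R.

(** The usual ultrametric, scaled so that the ball of radius [1/(n+1)] is the cylinder of length
    [n+1]. *)
Definition bit_dist x y : R :=
  if pselect (exists n, x n != y n) is left ne then ((ex_minn ne).+1%:R^-1)%R
  else 0%R.

Lemma bit_dist_lt x y n :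
  (bit_dist x y < n.+1%:R^-1)%R <-> restr x n.+1 = restr y n.+1.
Proof.
rewrite /bit_dist eq_restrP; case: pselect => [ne|eq]; last first.
  split=> _; last by rewrite invr_gt0 ltr0n.
  by move=> i _; apply/eqP/negPn/negP => xy; apply: eq; exists i.
case: ex_minnP => m mxy mmin; rewrite ltf_pV2 ?posrE ?ltr0n// ltr_nat ltnS.
split=> [nm i ni|xy]; last first.
  by rewrite ltnNge; apply/negP => mn; move/negP: mxy; apply; apply/eqP; exact: xy.
by apply/eqP/negPn/negP => /mmin; rewrite leqNgt (leq_trans ni).
Qed.

Lemma bit_dist_eq0 x y : bit_dist x y = 0%R <-> x = y.
Proof.
rewrite /bit_dist; case: pselect => [ne|eq].
  split=> [/eqP|xy]; first by rewrite invr_eq0 pnatr_eq0.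
  by exfalso; case: ne => n; rewrite xy eqxx.
split=> // _; apply/funext => i; apply/eqP/negPn/negP => xy.
by apply: eq; exists i.
Qed.

Lemma bit_dist_sym x y : bit_dist x y = bit_dist y x.
Proof.
rewrite /bit_dist; case: pselect => [ne|eq]; case: pselect => [ne'|eq']//.
- congr (_.+1%:R^-1)%R; by apply: eq_ex_minn => n; rewrite eq_sym.
- by exfalso; apply: eq'; case: ne => n xy; exists n; rewrite eq_sym.
- by exfalso; apply: eq; case: ne' => n xy; exists n; rewrite eq_sym.
Qed.

Lemma bit_dist_triangle y x z :
  (bit_dist x z <= bit_dist x y + bit_dist y z)%R.
Proof.
have ge0 u v : (0 <= bit_dist u v)%R.
  by rewrite /bit_dist; case: pselect.
rewrite {1}/bit_dist; case: pselect => [ne|_]; last by rewrite addr_ge0.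
(* Otherwise both distances are below [1/(m+1)], and [x], [y], [z] agree at [m], the first place
   where [x] and [z] differ. *)
case: ex_minnP => m mxz _; rewrite leNgt; apply/negP => lt.
have /bit_dist_lt/eq_restrP xy : (bit_dist x y < m.+1%:R^-1)%R.
  by rewrite (le_lt_trans _ lt)// lerDl.
have /bit_dist_lt/eq_restrP yz : (bit_dist y z < m.+1%:R^-1)%R.
  by rewrite (le_lt_trans _ lt)// lerDr.
by move/eqP: mxz; apply; rewrite xy// yz.
Qed.

HB.instance Definition _ := isMetric.Build R (bit_sequence R)
  (fun x => (bit_dist_eq0 x x).2 erefl) (fun x y => (bit_dist_eq0 x y).1)
  bit_dist_sym bit_dist_triangle.

Lemma ball_bit_sequence x n :
  ball x (n.+1%:R^-1)%R = [set y | restr y n.+1 = restr x n.+1].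
Proof.
rewrite ballEmdist; apply/seteqP; split=> y /=.
  by move/bit_dist_lt.
by move=> yx; apply/bit_dist_lt.
Qed.

Lemma nbhs_bit_sequence x (U : set (bit_sequence R)) :
  nbhs x U <->
  exists k, [set y : bit_sequence R | restr y k = restr x k] `<=` U.
Proof.
split=> [/nbhs_ballP[e /= e0 eU]|[k kU]].
  have [k] := ltr_add_invr e0; rewrite add0r => ke.
  exists k.+1; rewrite -ball_bit_sequence.
  by apply: subset_trans eU; apply: le_ball; exact: ltW.
apply/nbhs_ballP; exists (k.+1%:R^-1)%R; first by rewrite /= invr_gt0 ltr0n.
rewrite ball_bit_sequence => y /eq_restrP yx; apply: kU; apply/eq_restrP => i ik.
by apply: yx; exact: ltnW.
Qed.

Lemma polish_bit_sequence : polish (bit_sequence R).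
Proof.
split; first by exists (fun=> false).
  exists (range (fun s : seq bool => nth false s : bit_sequence R)).
    exact: (sub_countable (card_image_le _ _)) (countableP _).
  move=> U [x Ux] oU.
  have /nbhs_bit_sequence[k kU] := open_nbhs_nbhs (conj oU Ux).
  exists (nth false (restr x k)); split; last by exists (restr x k).
  by apply: kU => /=; rewrite -{2}(size_restr x k) restr_nth.
move=> F PF /cauchyP Fc.
(* A ball of radius [1/(k+1)] that belongs to [F] fixes the coordinate [k]; the limit is assembled
   from these values. *)
have Fconst k : exists b, F [set y : bit_sequence R | y k = b].
  have [|x Fx] := Fc (k.+1%:R^-1)%R; first by rewrite invr_gt0 ltr0n.
  exists (x k); apply: filterS Fx => y; rewrite ball_bit_sequence.
  by move=> /eq_restrP; apply.
have [sigma Fsigma] := choice Fconst.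
exists (sigma : bit_sequence R) => U /nbhs_bit_sequence[k kU].
apply: filterS kU _; elim: k => [|k IH]; first exact: filterS filterT.
apply: filterS2 IH (Fsigma k) => y /eq_restrP yx yk; apply/eq_restrP => i.
by rewrite ltnS leq_eqVlt => /predU1P[->//|/yx].
Qed.

End BitSequenceMetric.

(** Take [k+1 = 2^v (2n+1)]. This makes every candidate recur at arbitrarily late positions. *)
Lemma logn2_unbounded (v n : nat) : exists2 k, n <= k & logn 2 k.+1 = v.
Proof.
exists (2 ^ v * n.*2.+1).-1.
  have := leq_pmull n.*2.+1 (expn_gt0 2 v).
  by case: (_ * _) => //= m; rewrite ltnS; apply: leq_trans; rewrite -addnn leq_addr.
rewrite prednK ?muln_gt0 ?expn_gt0// lognM ?expn_gt0// pfactorK//.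
by rewrite logn_coprime ?addn0// coprime2n /= odd_double.
Qed.

(** * Arbitrary Polish spaces: candidate moves and the Banach-Mazur play *)

Section Polish.
Variables (R : realType) (X : metricType R).

Definition small (c : nat) (V : set X) : Prop :=
  exists x : X, V `<=` ball x (c.+1%:R^-1)%R.

Lemma separable_candidates : [set: X] !=set0 -> separable X ->
  exists B : nat -> set X,
    (forall k, open (B k) /\ B k !=set0) /\
    forall (U : set X) (c n : nat), open U -> U !=set0 ->
      exists k, [/\ n <= k, closure (B k) `<=` U & small c (B k)].
Proof.
move=> [x0 _] [D /countable_injP[code code_inj] denseD].
(* Candidates are interiors of balls around points of [D]; [x0] and [(0, 0)] are default values for
   numbers that code nothing. *)
pose center i := xget x0 [set x | D x /\ code x = i].
pose B k := let im := odflt (0, 0) (unpickle (logn 2 k.+1)) in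
  (ball (center im.1) (im.2.+1%:R^-1)%R)°.
have inv0 m : (0 < m.+1%:R^-1 :> R)%R by rewrite invr_gt0 ltr0n.
exists B; split=> [k|U c n oU [x Ux]].
  split; first exact: open_interior.
  by exists (center (odflt (0, 0) (unpickle (logn 2 k.+1))).1); exact: nbhsx_ballx.
have /nbhs_ballP[e /= e0 eU] := open_nbhs_nbhs (conj oU Ux).
(* A point of the closure is reached from [x] in three jumps: to the center [y], to a point of the
   ball, to its limit. *)
have [|m0] := @ltr_add_invr R 0%R (e / 3)%R; first by rewrite divr_gt0.
rewrite add0r => m0e; pose m := maxn m0 c.
have me : (m.+1%:R^-1 <= e / 3)%R.
  by rewrite (le_trans _ (ltW m0e))// lef_pV2 ?posrE ?ltr0n// ler_nat ltnS leq_maxl.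
have [||y [xy Dy]] := denseD ((ball x (m.+1%:R^-1)%R)°).
- by exists x; exact: nbhsx_ballx.
- exact: open_interior.
have yE : center (code y) = y.
  rewrite /center; case: xgetP => [z -> [Dz zy]|/(_ y)]; last by case.
  by apply: code_inj; rewrite ?inE.
have [k nk kE] := logn2_unbounded (pickle (code y, m)) n.
have BE : B k = (ball y (m.+1%:R^-1)%R)° by rewrite /B kE pickleK /= yE.
exists k; split=> //; last first.
  exists y; rewrite BE; apply: subset_trans (@interior_subset _ _) _.
  by apply: le_ball; rewrite lef_pV2 ?posrE ?ltr0n// ler_nat ltnS leq_maxr.
move=> z; rewrite BE => /(_ _ (nbhsx_ballx z _ (inv0 m)))[w].
move=> [/interior_subset yw /ball_sym wz].
apply: eU; apply: le_ball (ball_triangle (ball_triangle (interior_subset xy) yw) wz).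
apply: le_trans (lerD (lerD me me) me) _; lra.
Qed.

(* A finite bit sequence is read by a machine whose state (U, c, k) consists of
   the current open set U, the number c of moves made so far and the current
   position k. At position k, the bit [true] asks for a move to the k-th
   candidate, which takes place only if this candidate is small and well inside
   U. *)
Section Machine.
Variable B : nat -> set X.
Hypothesis B_open : forall k, open (B k) /\ B k !=set0.
Hypothesis B_fine : forall (U : set X) (c n : nat), open U -> U !=set0 ->
  exists k, [/\ n <= k, closure (B k) `<=` U & small c (B k)].

Let state : Type := set X * nat * nat.

Definition step (st : state) (b : bool) : state :=
  let: (U, c, k) := st in
  if b && `[< closure (B k) `<=` U /\ small c (B k) >]
  then (B k, c.+1, k.+1) else (U, c, k.+1).

Definition run (s : seq bool) : state := foldl step ([set: X], 0, 0) s.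

Definition region s := (run s).1.1.
Definition moves s := (run s).1.2.

Hypothesis X_neq0 : [set: X] !=set0.

Lemma run_position s : (run s).2 = size s.
Proof.
elim/last_ind: s => // s b; rewrite /run foldl_rcons -/(run s) size_rcons.
by case: (run s) => [[U c] k] /= <-; case: ifP.
Qed.

Lemma run_rcons s b : run (rcons s b) =
  if b && `[< closure (B (size s)) `<=` region s /\ small (moves s) (B (size s)) >]
  then (B (size s), (moves s).+1, (size s).+1)
  else (region s, moves s, (size s).+1).
Proof.
rewrite /run foldl_rcons -/(run s) -run_position /region /moves.
by case: (run s) => [[U c] k].
Qed.

Lemma region_open s : open (region s) /\ region s !=set0.
Proof.
elim/last_ind: s => [|s b IH]; first by split; [exact: openT|].
by rewrite /region run_rcons; case: ifP => // _; exact: B_open.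
Qed.

Lemma region_small s c : moves s = c.+1 -> small c (region s).
Proof.
elim/last_ind: s => // s b IH; rewrite /region /moves run_rcons.
by case: ifP => //= /andP[_ /asboolP[_ sB]] [<-].
Qed.

(** A move goes to a set whose closure lies in the current region. The clause on closures keeps
    limit points inside [region s]. *)
Lemma region_prefix s t : prefix s t ->
  [/\ region t `<=` region s, moves s <= moves t &
      moves s < moves t -> closure (region t) `<=` region s].
Proof.
move=> /prefixP[u ->]; elim/last_ind: u => [|u b [sub le cl]].
  by rewrite cats0; split=> //; rewrite ltnn.
rewrite -rcons_cat /region /moves run_rcons; case: ifP => //= /andP[_ /asboolP[Bsub _]].
have Bs : closure (B (size (s ++ u))) `<=` region s := subset_trans Bsub sub.
split=> //; first exact: subset_trans (@subset_closure _ _) Bs.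
exact: leqW.
Qed.

(** Waiting: bits [false] advance the position alone, up to that of a desired candidate. *)
Lemma run_falses s n : run (s ++ nseq n false) = (region s, moves s, size s + n).
Proof.
elim: n => [|n IH].
  by rewrite cats0 addn0 -run_position /region /moves; case: (run s) => [[]].
have -> : s ++ nseq n.+1 false = rcons (s ++ nseq n false) false.
  by rewrite -cats1 -catA -(nseqD n 1) addn1.
by rewrite run_rcons /= /region /moves IH size_cat size_nseq addnS.
Qed.

Lemma run_move s (V : set X) : open V -> V !=set0 -> V `<=` region s ->
  exists t, [/\ prefix s t, region t `<=` V & moves t = (moves s).+1].
Proof.
(* The bound [size s] ensures that the position [k] has not been passed yet. *)
move=> oV V0 Vs; have [k [sk BV Bsmall]] := B_fine (moves s) (size s) oV V0.
exists (rcons (s ++ nseq (k - size s) false) true).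
have sizeE : size (s ++ nseq (k - size s) false) = k.
  by rewrite size_cat size_nseq subnKC.
have runE := run_falses s (k - size s).
have good : `[< closure (B k) `<=` region s /\ small (moves s) (B k) >].
  by apply/asboolP; split=> //; exact: subset_trans BV Vs.
have runtE : run (rcons (s ++ nseq (k - size s) false) true) =
    (B k, (moves s).+1, k.+1).
  by rewrite run_rcons sizeE /region /moves runE /= -/(moves s) good.
split.
- by rewrite -cats1 -catA prefix_prefix.
- rewrite /region runtE; exact: subset_trans (@subset_closure _ _) BV.
- by rewrite {1}/moves runtE.
Qed.

Lemma run_moves s n : exists2 t, prefix s t & n <= moves t.
Proof.
elim: n => [|n [t st nt]]; first by exists s; first exact: prefix_refl.
have [ot t0] := region_open t.
have [u [tu _ uE]] := run_move ot t0 (@subset_refl _ _).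
by exists u; [exact: prefix_trans tu|rewrite uE].
Qed.

Lemma branch_point sigma : complete X ->
  (forall n, exists k, n < moves (restr sigma k)) ->
  exists x, forall k, region (restr sigma k) x.
Proof.
move=> cX unbounded; pose G := filter_from setT (fun k => region (restr sigma k)).
have sub i j : i <= j -> region (restr sigma j) `<=` region (restr sigma i).
  by move=> ij; have [] := region_prefix (prefix_restr sigma ij).
have GP : ProperFilter G.
  apply: filter_from_proper => [|k _]; last by have [] := region_open (restr sigma k).
  apply: filter_from_filter; first by exists 0.
  move=> i j _ _; exists (maxn i j) => // x xij.
  by split; apply: sub xij; rewrite ?leq_maxl ?leq_maxr.
have [|x Gx] := cX G GP.
  apply: cauchy_exP => e /ltr_add_invr[m]; rewrite add0r => me.
  (* After [c+1 > m] moves the region lies in a ball of radius [1/(c+1)], at most [1/(m+1)]. *)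
  have [k mk] := unbounded m; case E : (moves _) mk => [//|c] mc.
  have [x kx] := region_small E; exists x, k => //.
  apply: subset_trans kx _; apply: le_ball; rewrite (le_trans _ (ltW me))//.
  by rewrite lef_pV2 ?posrE ?ltr0n// ler_nat.
(* The limit [x] lies in the closure of each region; one more move after [k] puts such a closure
   inside the region at [k]. *)
exists x => k; have [j kj] := unbounded (moves (restr sigma k)).
have lekj : k <= j.
  case: (leqP k j) => // /ltnW jk.
  have [_ + _] := region_prefix (prefix_restr sigma jk).
  by rewrite leqNgt kj.
have [_ _ /(_ kj)] := region_prefix (prefix_restr sigma lekj); apply => V /Gx[i _ iV].
have [y yij] := (region_open (restr sigma (maxn i j))).2.
by exists y; split; [|apply: iV]; apply: sub yij; rewrite ?leq_maxl ?leq_maxr.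
Qed.

Lemma machine_baire_ideal I : ideal I -> complete X -> branch_property I ->
  baire_ideal I X.
Proof.
move=> [IT Ihered _ Ifin] cX branchI F ndF Fmono FX.
pose f s := [set A | [/\ I A, region s `&` F A = set0 &
                         exists2 i, i < moves s & ~ A i]].
have [| | | |sigma sigmaI] := branchI f.
- by move=> s A [].
- move=> s t /region_prefix[sub le _] A [IA sA [i im nAi]]; split=> //.
    by rewrite -subset0 -sA; exact: setSI.
  by exists i => //; exact: leq_trans le.
- move=> s A C CA [IA sA [i im nAi]]; have IC := Ihered _ _ CA IA; split=> //.
    by rewrite -subset0 -sA; apply: setIS; exact: Fmono.
  by exists i => // /CA.
- move=> s; apply/seteqP; split=> [A [t _ []//]|A IA].
  (* A proper ideal misses the whole set, so [A] omits some [i]. Play at least [i] moves, then one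
     more into a set missing [F A]. *)
  have [i nAi] : exists i, ~ A i.
    apply: contrapT => nA; apply: IT; suff <- : A = setT by [].
    rewrite -subTset => i _; apply: contrapT => nAi; apply: nA.
    by exists i.
  have [t st it] := run_moves s i.
  have [ot t0] := region_open t.
  have [V [oV V0 Vt VA]] := nowhere_dense_avoid (ndF A IA) ot t0.
  have [u [tu uV uE]] := run_move oV V0 Vt.
  exists u; first exact: prefix_trans tu.
  split=> //; first by rewrite -subset0 -VA; exact: setSI.
  by exists i => //; rewrite uE ltnS.
have [|x xs] := @branch_point sigma cX.
  (* Where [{0, ..., n}] enters along [sigma], some number above [n] is below the count of moves. *)
  move=> n; have : I `I_n.+1 by exact: Ifin (finite_II _).
  rewrite -sigmaI => -[k _ [_ _ [i ik /negP]]].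
  by rewrite -leqNgt => ni; exists k; exact: leq_trans ni (ltnW ik).
have : [set: X] x by [].
rewrite -FX => -[A IA xA]; move: (IA); rewrite -sigmaI => -[k _ [_ kA _]].
by suff : set0 x by []; rewrite -kA.
Qed.

End Machine.

Lemma polish_baire_ideal I : ideal I -> branch_property I -> polish X ->
  baire_ideal I X.
Proof.
move=> idealI branchI [X0 sX cX].
have [B [B_open B_fine]] := separable_candidates X0 sX.
exact: machine_baire_ideal B_open B_fine X0 I idealI cX branchI.
Qed.

End Polish.

Theorem corollary3p2 (R : realType) (I : set (set nat)) (hI : ideal I) :
  ((forall X : metricType R, polish X -> baire_ideal I X)
     <-> baire_ideal I cantor_space)
  /\ (baire_ideal I cantor_space <-> branch_property I).
Proof.
have [_ Ihered _ _] := hI.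
have surj (sigma : nat -> bool) : exists x : nat -> bool, x = sigma by exists sigma.
have cantor_branch : baire_ideal I cantor_space <-> branch_property I.
  split.
    exact: (branch_property_of_baire_ideal (X := cantor_space) surj
      nbhs_cantor_space).
  exact: (baire_ideal_of_branch_property (X := cantor_space) surj
    nbhs_cantor_space) Ihered.
split=> //; split=> [polishI|/cantor_branch branchI X].
  (* The hypothesis concerns metric spaces, so it is used for [bit_sequence R]; the branch property
     carries the result to [cantor_space]. *)
  apply/cantor_branch.
  apply: (branch_property_of_baire_ideal (X := bit_sequence R) surj
    (@nbhs_bit_sequence R)).
  exact: polishI (polish_bit_sequence R).
exact: polish_baire_ideal.
Qed.
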